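(* Consider the AIRPF algorithm described in the context, with parameters $S_m\in\mathbb{N}_0$, $m=2^{S_m}$, $M\in\mathbb{N}$, $N=mM$ and threshold $\tau\in(0,1]$. Let $\mathcal{F}_n:=\sigma(\boldsymbol{\xi}_{0,0},\ldots,\boldsymbol{\xi}_{n,0})$, where $\boldsymbol{\xi}_{p,s}:=(\boldsymbol{\xi}^1_{p,s},\ldots,\boldsymbol{\xi}^m_{p,s})$. Then for all $n\in\mathbb{N}_0$ and all $\varphi\in\mathcal{B}(\mathbb{X})$, $$\mathbb{E}\big[\pi^N_{n+1}(\varphi)\,\big|\,\mathcal{F}_n\big]=\frac{\pi^N_n\big(g_nK_{n+1}(\varphi)\big)}{\pi^N_n(g_n)}.$$
   Context: $(\mathbb{X},\mathcal{X})$ is a measurable space and $\mathcal{B}(\mathbb{X})$ is the set of bounded measurable real functions on $\mathbb{X}$. For a kernel $L$ and a function $f$, $L(f)(x)=\int f(y)L(x,\mathrm{d}y)$. The model consists of a probability measure $\pi_0$ on $\mathbb{X}$, Markov kernels $K_n$ on $\mathbb{X}$ ($n\ge 1$) and non-negative bounded measurable potential functions $g_n$ on $\mathbb{X}$ ($n\ge 0$); $g_nK_{n+1}(\varphi)$ denotes the function $x\mapsto g_n(x)K_{n+1}(\varphi)(x)$. AIRPF: for $s\in\{1,\ldots,S_m\}$ let $A_s=\mathbf{I}_{2^{S_m-s}}\otimes\tfrac12\mathbf{1}_2\otimes\mathbf{I}_{2^{s-1}}$ (an $m\times m$ matrix; $\otimes$ is the Kronecker product, $\mathbf{I}_\ell$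 the $\ell\times\ell$ identity, $\mathbf{1}_2$ the $2\times 2$ matrix of ones). For each time $n\in\mathbb{N}_0$ and stage $s\in\{0,\ldots,S_m\}$ there are $m$ filters $k=1,\ldots,m$, each with a particle block $\boldsymbol{\xi}^k_{n,s}=(\xi^{k,1}_{n,s},\ldots,\xi^{k,M}_{n,s})\in\mathbb{X}^M$ and a filter weight $W^k_{n,s}\ge 0$, generated as follows. (i) $W^k_{0,0}=1$ and $\boldsymbol{\xi}^k_{0,0}$, $k=1,\ldots,m$, are i.i.d. with law $\pi_0^{\otimes M}$. (ii) Internal resampling: $W^k_{n,1}=W^k_{n,0}\frac1M\sum_{i=1}^M g_n(\xi^{k,i}_{n,0})$ and, conditionally on the past and independently over $k,i$, $\xi^{k,i}_{n,1}$ is drawn from $\sum_{j=1}^M g_n(\xi^{k,j}_{n,0})\delta_{\xi^{k,j}_{n,0}}/\sum_{j=1}^M g_n(\xi^{k,j}_{n,0})$. (iii) For $s=1,\ldots,S_m$: the effective number of filters is $\mathcal{E}^{mM}_{n,s}=(m^{-1}\sum_kW^k_{n,s})^2/(m^{-1}\sum_k(W^k_{n,s})^2)$; set $\alpha_s=A_s$ if $\mathcal{E}^{mM}_{n,s}<\tau$ and $\alpha_s=\mathbf{I}_m$ otherwise; $W^k_{n,s+1}=\sum_{\ell=1}^m\alpha_s^{k\ell}W^\ell_{n,s}$; conditionally on the past and independently over $k$, an index $L_k$ is drawn with $\mathbb{P}(L_k=\ell)=\alpha_s^{k\ell}W^\ell_{n,s}/W^k_{n,s+1}$; if $s<S_m$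 then $\boldsymbol{\xi}^k_{n,s+1}=\boldsymbol{\xi}^{L_k}_{n,s}$; if $s=S_m$ then $W^k_{n+1,0}=W^k_{n,S_m+1}$ and $\boldsymbol{\xi}^k_{n+1,0}$ is drawn from $K_{n+1}^{\otimes M}(\boldsymbol{\xi}^{L_k}_{n,S_m},\cdot)=K_{n+1}(\xi^{L_k,1}_{n,S_m},\cdot)\otimes\cdots\otimes K_{n+1}(\xi^{L_k,M}_{n,S_m},\cdot)$. (When $S_m=0$, $W_{n+1,0}=W_{n,1}$ and $\boldsymbol{\xi}_{n+1,0}\sim K^{\otimes M}_{n+1}(\boldsymbol{\xi}_{n,1},\cdot)$.) Output: $\pi^N_{n,s}=\dfrac{\sum_{k=1}^mW^k_{n,s}\frac1M\sum_{i=1}^M\delta_{\xi^{k,i}_{n,s}}}{\sum_{k=1}^mW^k_{n,s}}$ and $\pi^N_n=\pi^N_{n,0}$. *)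

(* Defs.v *)
From HB Require Import structures.
From mathcomp Require Import all_boot all_order all_algebra.
From mathcomp Require Import all_classical all_reals all_analysis.
From mathcomp.real_closed Require Import mxtens.

Set Implicit Arguments.
Unset Strict Implicit.
Unset Printing Implicit Defensive.

Import Order.TTheory GRing.Theory Num.Theory.
Local Open Scope classical_set_scope.
Local Open Scope ring_scope.

(* A_s = I_{2^(S-s)} (x) (1/2) 1_2 (x) I_{2^(s-1)}, an m x m matrix
   (conform_mx only re-types the Kronecker product, whose dimension
   2^(S-s) * 2 * 2^(s-1) equals 2^S for 1 <= s <= S). *)
Definition Amat (R : realType) (S s : nat) : 'M[R]_(2 ^ S) :=
  conform_mx 0
    (tensmx (tensmx (1%:M : 'M[R]_(2 ^ (S - s)))
                    ((2%:R)^-1 *: const_mx 1 : 'M[R]_2))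
            (1%:M : 'M[R]_(2 ^ s.-1))).

Definition ess (R : realType) (m : nat) (w : 'I_m -> R) : R :=
  (m%:R^-1 * \sum_k w k) ^+ 2 / (m%:R^-1 * \sum_k w k ^+ 2).

Definition alpha (R : realType) (S : nat) (tau : R) (s : nat)
  (w : 'I_(2 ^ S) -> R) : 'M[R]_(2 ^ S) :=
  if ess w < tau then Amat R S s else 1%:M.

Definition mixW (R : realType) (S : nat) (tau : R) (s : nat)
  (w : 'I_(2 ^ S) -> R) : 'I_(2 ^ S) -> R :=
  fun k => \sum_l alpha tau s w k l * w l.

(* Wmid w1 s = W_{n,s+1} when w1 = W_{n,1} *)
Fixpoint Wmid (R : realType) (S : nat) (tau : R) (w1 : 'I_(2 ^ S) -> R)
  (s : nat) : 'I_(2 ^ S) -> R :=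
  match s with
  | 0 => w1
  | s'.+1 => mixW tau s'.+1 (Wmid tau w1 s')
  end.

Definition Wn1 (R : realType) (X : Type) (m M : nat) (gn : X -> R)
  (w0 : 'I_m -> R) (x : 'I_m -> 'I_M -> X) : 'I_m -> R :=
  fun k => w0 k * (M%:R^-1 * \sum_i gn (x k i)).

(* W_{n,0}, given all stage-0 particle blocks x n = xi_{n,0} *)
Fixpoint W0 (R : realType) (X : Type) (S M : nat) (tau : R)
  (g : nat -> X -> R) (x : nat -> 'I_(2 ^ S) -> 'I_M -> X) (n : nat)
  : 'I_(2 ^ S) -> R :=
  match n with
  | 0 => fun _ => 1
  | n'.+1 => Wmid tau (Wn1 (g n') (W0 tau g x n') (x n')) S
  end.

Definition Wgt (R : realType) (X : Type) (S M : nat) (tau : R)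
  (g : nat -> X -> R) (x : nat -> 'I_(2 ^ S) -> 'I_M -> X) (n s : nat)
  : 'I_(2 ^ S) -> R :=
  match s with
  | 0 => W0 tau g x n
  | s'.+1 => Wmid tau (Wn1 (g n) (W0 tau g x n) (x n)) s'
  end.

Definition piN (R : realType) (X : Type) (m M : nat) (w : 'I_m -> R)
  (x : 'I_m -> 'I_M -> X) (f : X -> R) : R :=
  (\sum_k w k * (M%:R^-1 * \sum_i f (x k i))) / \sum_k w k.

Definition Kop (R : realType) (dX : measure_display) (X : measurableType dX)
  (L : R.-pker X ~> X) (f : X -> R) (x : X) : R :=
  fine (\int[L x]_y (f y)%:E).

(* Order in which the random objects are generated within the algorithm:
   xi_{n,0}, xi_{n,1}, L_{n,1}, xi_{n,2}, L_{n,2}, ..., xi_{n,S}, L_{n,S},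
   xi_{n+1,0}, ...                                                          *)
Definition rank_xi (S n s : nat) : nat :=
  if s == 0%N then (n * (2 * S + 2))%N else (n * (2 * S + 2) + 2 * s - 1)%N.
Definition rank_L (S n s : nat) : nat := (n * (2 * S + 2) + 2 * s)%N.

Definition past (dO : measure_display) (Om : measurableType dO)
  (dX : measure_display) (X : measurableType dX) (S M : nat)
  (xi : nat -> nat -> 'I_(2 ^ S) -> 'I_M -> Om -> X)
  (L : nat -> nat -> 'I_(2 ^ S) -> Om -> 'I_(2 ^ S)) (t : nat)
  : set (set Om) :=
  <<s [set E | (exists p s k i (B : set X),
                  [/\ (s <= S)%N, (rank_xi S p s < t)%N, measurable B &
                      E = xi p s k i @^-1` B])
             \/ (exists p s k l,
                  [/\ (1 <= s <= S)%N, (rank_L S p s < t)%N &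
                      E = L p s k @^-1` [set l]])] >>.

Definition filtF (dO : measure_display) (Om : measurableType dO)
  (dX : measure_display) (X : measurableType dX) (S M : nat)
  (xi : nat -> nat -> 'I_(2 ^ S) -> 'I_M -> Om -> X) (n : nat)
  : set (set Om) :=
  <<s [set E | exists p k i (B : set X),
         [/\ (p <= n)%N, measurable B & E = xi p 0%N k i @^-1` B]] >>.

(* internal resampling probability of the set B for filter k at time n
   (uniform if all the potentials of the block vanish; such a filter has
   weight 0) *)
Definition qres (R : realType) (X : Type) (M : nat) (gn : X -> R)
  (x : 'I_M -> X) (B : set X) : R :=
  let D := \sum_j gn (x j) in
  if D == 0 then M%:R^-1 * \sum_j \1_B (x j)
  else (\sum_j gn (x j) * \1_B (x j)) / D.

Definition pL (R : realType) (S : nat) (tau : R) (s : nat)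
  (ws ws1 : 'I_(2 ^ S) -> R) (k l : 'I_(2 ^ S)) : R :=
  if ws1 k == 0 then (l == k)%:R
  else alpha tau s ws k l * ws l / ws1 k.

(* A realization of the AIRPF on the probability space (Om, P):
   xi n s k i = xi^{k,i}_{n,s} (s = 0..S), L n s k = L_k at stage s of
   time n (s = 1..S).  The weights are the deterministic functions Wgt of
   the stage-0 particles. *)
Record AIRPF (R : realType) (dO : measure_display) (Om : measurableType dO)
  (P : probability Om R) (dX : measure_display) (X : measurableType dX)
  (S M : nat) (tau : R) (pi0 : probability X R)
  (K : nat -> R.-pker X ~> X) (g : nat -> X -> R) := {
  xi : nat -> nat -> 'I_(2 ^ S) -> 'I_M -> Om -> X;
  Lidx : nat -> nat -> 'I_(2 ^ S) -> Om -> 'I_(2 ^ S);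
  xi_meas : forall n s k i, measurable_fun setT (xi n s k i);
  Lidx_meas : forall n s k l, measurable (Lidx n s k @^-1` [set l]);
  (* (i) W_{0,0} = 1 (built into Wgt) and xi_{0,0}^k i.i.d. ~ pi0^{(x)M} *)
  init : forall B : 'I_(2 ^ S) -> 'I_M -> set X,
    (forall k i, measurable (B k i)) ->
    P [set w | forall k i, B k i (xi 0 0 k i w)] =
    (\prod_k \prod_i fine (pi0 (B k i)))%:E;
  resample : forall n (A : set Om) (B : 'I_(2 ^ S) -> 'I_M -> set X),
    past xi Lidx (rank_xi S n 1) A ->
    (forall k i, measurable (B k i)) ->
    P (A `&` [set w | forall k i, B k i (xi n 1 k i w)]) =
    (\int[P]_(w in A)
      (\prod_k \prod_i qres (g n) (fun j => xi n 0 k j w) (B k i))%:E)%E;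
  select : forall n s (A : set Om) (l : 'I_(2 ^ S) -> 'I_(2 ^ S)),
    (1 <= s <= S)%N ->
    past xi Lidx (rank_L S n s) A ->
    P (A `&` [set w | forall k, Lidx n s k w = l k]) =
    (\int[P]_(w in A)
      (\prod_k pL tau s (Wgt tau g (fun p k i => xi p 0 k i w) n s)
                       (Wgt tau g (fun p k i => xi p 0 k i w) n s.+1)
                       k (l k))%:E)%E;
  copy : forall n s k i w, (1 <= s < S)%N ->
    xi n s.+1 k i w = xi n s (Lidx n s k w) i w;
  mutate : forall n (A : set Om) (B : 'I_(2 ^ S) -> 'I_M -> set X),
    past xi Lidx (rank_xi S n.+1 0) A ->
    (forall k i, measurable (B k i)) ->
    P (A `&` [set w | forall k i, B k i (xi n.+1 0 k i w)]) =
    (\int[P]_(w in A)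
      (\prod_k \prod_i
         fine (K n.+1 (if S == 0%N then xi n 1 k i w
                       else xi n S (Lidx n S k w) i w) (B k i)))%:E)%E }.

Definition piNn (R : realType) (dO : measure_display) (Om : measurableType dO)
  (P : probability Om R) (dX : measure_display) (X : measurableType dX)
  (S M : nat) (tau : R) (pi0 : probability X R)
  (K : nat -> R.-pker X ~> X) (g : nat -> X -> R)
  (A : AIRPF P S M tau pi0 K g) (n : nat) (f : X -> R) (w : Om) : R :=
  piN (Wgt tau g (fun p k i => xi A p 0 k i w) n 0)
      (fun k i => xi A n 0 k i w) f.

Definition cond_exp (R : realType) (dO : measure_display)
  (Om : measurableType dO) (P : probability Om R) (F : set (set Om))
  (Y Z : Om -> R) : Prop :=
  [/\ P.-integrable setT (EFin \o Y),
      P.-integrable setT (EFin \o Z),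
      (forall B : set R, measurable B -> F (Z @^-1` B)) &
      (forall A, F A ->
         (\int[P]_(w in A) (Y w)%:E = \int[P]_(w in A) (Z w)%:E)%E)].

(* Main.v *)
(* Fix n and let T be the total weight after internal resampling. Every mixing
   matrix alpha_s is column stochastic, so the total weight stays T through all
   the stages and pi^N_{n+1}(phi) is the average over i of
   sum_k (W^k_{n,S+1} / T) phi(xi^{k,i}_{n+1,0}). All weights of time n are
   F_n-measurable. Integrating against an F_n-measurable Z, the mutation step
   replaces phi by K_{n+1} phi at the selected particle; at stage s,
   W^k_{s+1} P(L_k = l) = alpha_s^{kl} W^l_s, and summing over k removes both
   the selection and alpha_s, so the weighted sum is unchanged down to s = 1;
   there the resampling step gives W^k_0 M^-1 sum_j g phi', phi' = K_{n+1} phi.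
   If T = 0 both sides of the theorem are 0 by the convention x / 0 = 0. *)

Require Import Defs.
From HB Require Import structures.
From mathcomp Require Import all_boot all_order all_algebra.
From mathcomp Require Import all_classical all_reals all_analysis.
From mathcomp Require Import measurable_realfun.
From mathcomp Require Import ring lra zify.
From mathcomp.real_closed Require Import mxtens.

Set Implicit Arguments.
Unset Strict Implicit.
Unset Printing Implicit Defensive.

Import Order.TTheory GRing.Theory Num.Theory.
Local Open Scope classical_set_scope.
Local Open Scope ring_scope.

(** * Bounded measurable functions and linear functionals *)

Definition bmeas {d : measure_display} {T : measurableType d} {R : realType}
    (f : T -> R) :=
  measurable_fun setT f /\ exists c, forall x, `|f x| <= c.

Section bounded_measurable.
Context {d : measure_display} {T : measurableType d} {R : realType}.
Implicit Types f h : T -> R.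

Lemma bmeas_cst (c : R) : bmeas (fun _ : T => c).
Proof. by split; [exact: measurable_cst | exists `|c|]. Qed.

Lemma bmeasD f h : bmeas f -> bmeas h -> bmeas (fun x => f x + h x).
Proof.
move=> [mf [c fc]] [mh [c' hc]]; split; first exact: measurable_funD.
by exists (c + c') => x; rewrite (le_trans (ler_normD _ _))// lerD.
Qed.

Lemma bmeasM f h : bmeas f -> bmeas h -> bmeas (fun x => f x * h x).
Proof.
move=> [mf [c fc]] [mh [c' hc]]; split; first exact: measurable_funM.
by exists (c * c') => x; rewrite normrM ler_pM.
Qed.

Lemma bmeas_sum (I : Type) (s : seq I) (f : I -> T -> R) :
  (forall i, bmeas (f i)) -> bmeas (fun x => \sum_(i <- s) f i x).
Proof.
move=> bf; elim: s => [|i s IHs].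
  by under eq_fun do rewrite big_nil; exact: bmeas_cst.
by under eq_fun do rewrite big_cons; exact: bmeasD.
Qed.

Lemma bmeas_indic (B : set T) : measurable B -> bmeas (\1_B : T -> R).
Proof.
move=> mB; split; first exact: measurable_indic.
by exists 1 => x; rewrite indicE; case: (_ \in _); rewrite (normr0, normr1).
Qed.

(* For [z >= 0], [powR z (-1)] is [z^-1], including at [z = 0]. *)
Lemma measurable_fun_inv f : measurable_fun setT f ->
  measurable_fun setT (fun x => (f x)^-1).
Proof.
move=> mf.
rewrite (_ : (fun _ => _) = (fun x => f x * powR (f x ^+ 2) (-1))); last first.
  apply/funext => x; rewrite powR_inv1 ?sqr_ge0//.
  have [->|fx0] := eqVneq (f x) 0; first by rewrite invr0 mul0r.
  by rewrite expr2 invfM mulrA mulfV// mul1r.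
apply: measurable_funM => //.
apply: (measurableT_comp (measurable_powR (-1))).
exact: measurable_funX.
Qed.

Lemma bmeas_integrable (mu : {measure set T -> \bar R}) f :
  (mu setT < +oo)%E -> bmeas f -> mu.-integrable setT (EFin \o f).
Proof.
move=> mufin [mf [c fc]]; apply: measurable_bounded_integrable => //.
exists c; split; first exact: num_real.
by move=> r cr x _ /=; rewrite (le_trans (fc x))// ltW.
Qed.

End bounded_measurable.

Lemma bmeas_comp d d' (T : measurableType d) (T' : measurableType d')
    (R : realType) (f : T' -> R) (y : T -> T') :
  measurable_fun setT y -> bmeas f -> bmeas (f \o y).
Proof.
move=> my [mf [c fc]]; split; first exact: measurableT_comp.
by exists c => x; exact: fc.
Qed.

(** The uniform bound on [0, 1]-valued functions takes the place of a continuity assumption. With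
    it, an identity between two such functionals passes from indicators to bounded measurable
    functions without a monotone class argument. *)
Definition blinear d (T : measurableType d) (R : realType)
    (L : (T -> R) -> R) :=
  (forall a f h, bmeas f -> bmeas h ->
     L (fun x => a * f x + h x) = a * L f + L h) /\
  exists C, forall f, bmeas f -> (forall x, 0 <= f x <= 1) -> `|L f| <= C.

Section blinear.
Context d (T : measurableType d) (R : realType).
Implicit Types (L : (T -> R) -> R) (f : T -> R).

(* Binary expansion: with [B = {f >= 1/2}], [f = 1/2 * 1_B + 1/2 * f'] where
   [f' = 2 f - 1_B] again takes its values in [0, 1]; hence
   [L f = 1/2 * L f'], and iterating gives [`|L f| <= 2^-n * C]. *)
Lemma blinear_indic_eq0 L : blinear L ->
  (forall B, measurable B -> L \1_B = 0) -> forall f, bmeas f -> L f = 0.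
Proof.
move=> [linL [C LC]] L1.
(* The zero function is [\1_set0], so homogeneity is the case of [linL] in which the second function
   is an indicator. *)
have LZ a f : bmeas f -> L (fun x => a * f x) = a * L f.
  move=> bf; rewrite -[RHS]addr0 -(L1 set0)// -linL//; last exact: bmeas_indic.
  by congr L; apply/funext => x; rewrite indicE in_set0 addr0.
have halve n : forall f, bmeas f -> (forall x, 0 <= f x <= 1) ->
    `|L f| <= C / 2 ^+ n.
  elim: n => [|n IHn] f bf f01; first by rewrite expr0 divr1; exact: LC.
  pose B := [set x | 2^-1 <= f x].
  have mB : measurable B.
    rewrite -[B]setTI; case: bf => mf _.
    rewrite (_ : B = f @^-1` `[2^-1, +oo[); first exact: mf.
    by apply/seteqP; split => x /=; rewrite in_itv/= andbT.
  pose f' x := -1 * \1_B x + 2 * f x.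
  have b1 : bmeas (\1_B : T -> R) by exact: bmeas_indic.
  have b2 : bmeas (fun x => 2 * f x) by apply: bmeasM => //; exact: bmeas_cst.
  have bf' : bmeas f'.
    by apply: bmeasD => //; apply: bmeasM => //; exact: bmeas_cst.
  have f'01 x : 0 <= f' x <= 1.
    have := f01 x; rewrite /f' indicE.
    case: (boolP (x \in B)) => /=.
      by rewrite inE /B/= => h1 h2; apply/andP; split; lra.
    by rewrite notin_setE /B/= => /negP; rewrite -ltNge => h1 h2;
      apply/andP; split; lra.
  have Lf' : L f' = 2 * L f.
    by rewrite linL// L1// mulr0 add0r LZ.
  have := IHn _ bf' f'01; rewrite Lf' normrM normr_nat exprS invfM.
  by rewrite mulrCA; set z := C / _; lra.
move=> f bf; have [_ [c fc]] := bf.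
have L01 h : bmeas h -> (forall x, 0 <= h x <= 1) -> L h = 0.
  move=> bh h01; apply/eqP; rewrite -normr_eq0 eq_le normr_ge0 andbT.
  apply/ler_addgt0Pr => e e0; rewrite add0r.
  have C0 : 0 <= C.
    apply: le_trans (LC (\1_set0) _ _) => //; first exact: bmeas_indic.
    by move=> x; rewrite indicE in_set0 lexx ler01.
  have [n Cn] : exists n, C / e < 2 ^+ n.
    exists (Num.truncn (C / e)).+1.
    apply: lt_trans (truncnS_gt _) _.
    by rewrite -natrX ltr_nat ltn_expl.
  apply: (le_trans (halve n h bh h01)).
  rewrite ler_pdivrMr ?exprn_gt0//; move: Cn.
  by rewrite ltr_pdivrMr// mulrC => /ltW.
have c0 : 0 < `|c| + 1 by rewrite ltr_wpDl.
(* The affine map [h] carries [-k, k] into [0, 1]. The constant it adds is a multiple of [\1_setT],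
   which [L] kills, so [L h = 0] gives [L f = 0]. *)
pose k := `|c| + 1.
pose h x := (2 * k)^-1 * f x + 2^-1.
have bh : bmeas h.
  by apply: bmeasD; [apply: bmeasM => //|]; exact: bmeas_cst.
have Lh : L h = 0.
  apply: L01 => // x.
  have hE : h x * (2 * k) = f x + k.
    by rewrite /h; field; rewrite gt_eqF.
  have := fc x; rewrite ler_norml => fcx.
  have := ler_norm c => cc.
  have k0 : 0 < 2 * k by rewrite mulr_gt0.
  rewrite -(pmulr_lge0 _ k0) -[h x <= 1](ler_pM2r k0) hE mul1r /k.
  by apply/andP; split; lra.
move: Lh; rewrite linL//; last exact: bmeas_cst.
rewrite (_ : (fun=> _) = (fun x => 2^-1 * \1_setT x)); last first.
  by apply/funext => x; rewrite indicT mulr1.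
rewrite LZ; last exact: bmeas_indic.
rewrite (L1 setT)// mulr0 addr0 => /eqP; rewrite mulf_eq0 invr_eq0 mulf_eq0.
by rewrite pnatr_eq0/= gt_eqF//= => /eqP.
Qed.

Lemma blinear_ext L L' : blinear L -> blinear L' ->
  (forall B, measurable B -> L \1_B = L' \1_B) ->
  forall f, bmeas f -> L f = L' f.
Proof.
move=> [linL [C LC]] [linL' [C' LC']] LL' f bf.
apply/eqP; rewrite -subr_eq0; apply/eqP.
apply: (blinear_indic_eq0 (L := fun f => L f - L' f)) => //.
- split=> [a f1 f2 b1 b2|]; first by rewrite linL// linL'//; ring.
  exists (C + C') => h bh h01; apply: (le_trans (ler_normB _ _)).
  by apply: lerD; [exact: LC | exact: LC'].
- by move=> B mB; rewrite LL'// subrr.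
Qed.

End blinear.

(** * Integration against a finite measure *)

Section expectation.
Context d (T : measurableType d) (R : realType).
Variable mu : {measure set T -> \bar R}.
Hypothesis mu_fin : (mu setT < +oo)%E.
Local Notation E f := (Rintegral mu setT f).

Lemma E_linear a (f h : T -> R) : bmeas f -> bmeas h ->
  E (fun x => a * f x + h x) = a * E f + E h.
Proof.
move=> bf bh; rewrite RintegralD//.
- by rewrite RintegralZl//; exact: bmeas_integrable.
- by apply: bmeas_integrable => //; apply: bmeasM => //; exact: bmeas_cst.
- exact: bmeas_integrable.
Qed.

Lemma E_bound c (f : T -> R) : bmeas f -> (forall x, `|f x| <= c) ->
  `|E f| <= c * fine (mu setT).
Proof.
move=> bf fc; have ibf := bmeas_integrable mu_fin bf.
apply: (le_trans (le_normr_Rintegral _ ibf)) => //.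
rewrite -Rintegral_cst//; apply: le_Rintegral => //.
- apply: bmeas_integrable => //; case: bf => mf _; split.
    exact: measurableT_comp.
  by exists c => x; rewrite normr_id.
- by apply: bmeas_integrable => //; exact: bmeas_cst.
Qed.

Lemma E_sum (I : Type) (s : seq I) (f : I -> T -> R) :
  (forall i, bmeas (f i)) ->
  E (fun x => \sum_(i <- s) f i x) = \sum_(i <- s) E (f i).
Proof.
move=> bf; elim: s => [|i s IHs].
  rewrite big_nil; under eq_fun do rewrite big_nil.
  by rewrite Rintegral_cst// mul0r.
rewrite big_cons -IHs -[E (f i)]mul1r -E_linear//; last exact: bmeas_sum.
by congr Rintegral; apply/funext => x; rewrite big_cons mul1r.
Qed.

(** Covers the two functionals compared later: evaluation of f at a random point, and averaging of f
    against the prescribed conditional law of that point. *)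
Lemma blinear_E d' (T' : measurableType d') (U : T -> R)
    (L : (T' -> R) -> T -> R) :
  bmeas U -> (forall f, bmeas f -> bmeas (L f)) ->
  (forall a f h, bmeas f -> bmeas h -> forall x,
     L (fun z => a * f z + h z) x = a * L f x + L h x) ->
  (exists C, forall f, bmeas f -> (forall z, 0 <= f z <= 1) ->
     forall x, `|L f x| <= C) ->
  blinear (fun f => E (fun x => U x * L f x)).
Proof.
move=> bU bL linL [C LC]; split=> [a f h bf bh|].
  rewrite -E_linear; [|by apply: bmeasM => //; exact: bL..].
  by congr Rintegral; apply/funext => x; rewrite linL//; ring.
have [_ [c Uc]] := bU.
exists (c * C * fine (mu setT)) => f bf f01; apply: E_bound.
  by apply: bmeasM => //; exact: bL.
by move=> x; rewrite normrM ler_pM//; exact: LC.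
Qed.

Lemma blinear_E_comp d' (T' : measurableType d') (U : T -> R) (y : T -> T') :
  bmeas U -> measurable_fun setT y ->
  blinear (fun f => E (fun x => U x * f (y x))).
Proof.
move=> bU my; apply: (blinear_E (L := fun f x => f (y x))) => //.
- by move=> f bf; exact: (bmeas_comp (f := f) (y := y)).
- by exists 1 => f _ f01 x; have /andP[? ?] := f01 (y x); rewrite ger0_norm.
Qed.

Lemma E_indicl (A : set T) (f : T -> R) :
  E (fun x => \1_A x * f x) = fine (\int[mu]_(x in A) (f x)%:E)%E.
Proof.
rewrite -[RHS]/(Rintegral mu A f) [RHS]Rintegral_mkcond.
rewrite (patch_indic f); congr Rintegral; apply/funext => x.
by rewrite /= mulrC.
Qed.

Lemma E_indic (A : set T) : measurable A -> E (\1_A) = fine (mu A).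
Proof. by move=> mA; rewrite /Rintegral integral_indic// setIT. Qed.

Lemma E_indicI (A B : set T) : measurable A -> measurable B ->
  E (fun x => \1_A x * \1_B x) = fine (mu (A `&` B)).
Proof.
move=> mA mB; rewrite -E_indic; last exact: measurableI.
by congr Rintegral; rewrite indicI.
Qed.

End expectation.

(** * Generated sigma-algebras and conditioning *)

Section sub_sigma_algebra.
Context d (T : measurableType d).
Implicit Types G : set (set T).

Lemma g_sigma_sub G : (forall A, G A -> measurable A) ->
  forall A, <<s G >> A -> measurable A.
Proof.
by move=> GT; apply: smallest_sub => //; exact: sigma_algebra_measurable.
Qed.

Lemma g_sigma_mono G G' : (forall A, G A -> <<s G' >> A) ->
  forall A, <<s G >> A -> <<s G' >> A.
Proof.
by move=> GG'; apply: smallest_sub => //; exact: smallest_sigma_algebra.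
Qed.

Lemma measurable_sub d' (T' : measurableType d') G (f : T -> T') :
  (forall A, G A -> measurable A) ->
  measurable_fun [set: g_sigma_algebraType G] f -> measurable_fun setT f.
Proof.
move=> GT mf _ B mB; apply: (g_sigma_sub GT).
exact: (mf measurableT).
Qed.

End sub_sigma_algebra.

Section conditional_extension.
Context d (T : measurableType d) (R : realType).
Variable mu : {measure set T -> \bar R}.
Hypothesis mu_fin : (mu setT < +oo)%E.
Local Notation E f := (Rintegral mu setT f).

(** Both sides are bounded linear functionals of Z on the space T equipped with the sigma-algebra
    generated by G, and the hypothesis says that they agree on its indicators. *)
Lemma E_extend (G : set (set T)) (U V : T -> R) :
  (forall A, G A -> measurable A) -> bmeas U -> bmeas V ->
  (forall A, <<s G >> A ->
     E (fun x => \1_A x * U x) = E (fun x => \1_A x * V x)) ->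
  forall Z : T -> R, @bmeas _ (g_sigma_algebraType G) R Z ->
  E (fun x => Z x * U x) = E (fun x => Z x * V x).
Proof.
move=> GT bU bV UV Z bZ.
(* The identity, seen as a map to the coarser measurable space, is the y of [blinear_E_comp]. *)
have mid : measurable_fun [set: T] (id : T -> g_sigma_algebraType G).
  by move=> _ B mB; rewrite setTI; exact: (g_sigma_sub GT).
have EC (X : T -> R) (f : T -> R) :
    E (fun x => f x * X x) = E (fun x => X x * f x).
  by congr Rintegral; apply/funext => x; rewrite mulrC.
rewrite (EC U) (EC V).
apply: (blinear_ext (T := g_sigma_algebraType G)
  (L := fun f => E (fun x => U x * f x))
  (L' := fun f => E (fun x => V x * f x))).
- exact: (blinear_E_comp mu_fin (T' := g_sigma_algebraType G) (y := id)).
- exact: (blinear_E_comp mu_fin (T' := g_sigma_algebraType G) (y := id)).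
- by move=> B mB; rewrite -(EC U) -(EC V); exact: UV.
- exact: bZ.
Qed.

(** Turns a law prescribed on events into an identity for functions, first reducing Z to the
    indicator of A, then f to the indicator of B. [L f] need not be measurable for G: the conclusion
    is that [f (y x)] and [L f x] have the same conditional expectation. *)
Lemma E_cond_step (G : set (set T)) d' (T' : measurableType d') (y : T -> T')
    (L : (T' -> R) -> T -> R) :
  (forall A, G A -> measurable A) -> measurable_fun setT y ->
  (forall f, bmeas f -> bmeas (L f)) ->
  (forall a f h, bmeas f -> bmeas h -> forall x,
     L (fun z => a * f z + h z) x = a * L f x + L h x) ->
  (exists C, forall f, bmeas f -> (forall z, 0 <= f z <= 1) ->
     forall x, `|L f x| <= C) ->
  (forall A B, <<s G >> A -> measurable B ->
     mu (A `&` y @^-1` B) = (\int[mu]_(x in A) (L \1_B x)%:E)%E) ->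
  forall (Z : T -> R) f, @bmeas _ (g_sigma_algebraType G) R Z -> bmeas f ->
  E (fun x => Z x * f (y x)) = E (fun x => Z x * L f x).
Proof.
move=> GT my bL linL LC AB Z f bZ bf.
apply: (E_extend GT _ _ _ bZ); [exact: (bmeas_comp my bf)|exact: bL|].
move=> A GA; have mA := g_sigma_sub GT GA.
apply: (blinear_ext (L := fun f => E (fun x => \1_A x * f (y x)))
  (L' := fun f => E (fun x => \1_A x * L f x))) => //.
- by apply: blinear_E_comp => //; exact: bmeas_indic.
- by apply: blinear_E => //; exact: bmeas_indic.
- move=> B mB; rewrite [RHS]E_indicl -AB// -E_indicI//.
  by rewrite -[y @^-1` B]setTI; exact: my.
Qed.

End conditional_extension.

Lemma measurable_mono d (T : measurableType d) d' (T' : measurableType d')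
    (G G' : set (set T)) (f : T -> T') :
  (forall A, G A -> <<s G' >> A) ->
  measurable_fun [set: g_sigma_algebraType G] f ->
  measurable_fun [set: g_sigma_algebraType G'] f.
Proof.
by move=> GG' mf _ B mB; apply: (g_sigma_mono GG'); exact: (mf measurableT).
Qed.

Lemma bmeas_mono d (T : measurableType d) (R : realType)
    (G G' : set (set T)) (f : T -> R) :
  (forall A, G A -> <<s G' >> A) ->
  @bmeas _ (g_sigma_algebraType G) R f -> @bmeas _ (g_sigma_algebraType G') R f.
Proof. by move=> GG' [mf bf]; split => //; exact: (measurable_mono GG' mf). Qed.

Lemma bmeas_sub d (T : measurableType d) (R : realType)
    (G : set (set T)) (f : T -> R) :
  (forall A, G A -> measurable A) ->
  @bmeas _ (g_sigma_algebraType G) R f -> bmeas f.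
Proof. by move=> GT [mf bf]; split => //; exact: (measurable_sub GT mf). Qed.


(** * Weights *)

Definition colstoch (R : realType) (m : nat) (A : 'M[R]_m) :=
  (forall i j, 0 <= A i j) /\ (forall j, \sum_i A i j = 1).

Section colstoch.
Context {R : realType}.

Lemma colstoch1 m : colstoch (1%:M : 'M[R]_m).
Proof.
split=> [i j|j]; first by rewrite mxE ler0n.
rewrite (bigD1 j)//= mxE eqxx big1 ?addr0// => i ij.
by rewrite mxE (negbTE ij).
Qed.

(** Splitting the row index into a pair makes each column sum a product of a column sum of A and one
    of B. *)
Lemma colstoch_tens m p (A : 'M[R]_m) (B : 'M[R]_p) :
  colstoch A -> colstoch B -> colstoch (tensmx A B).
Proof.
move=> [A0 A1] [B0 B1]; split=> [i j|j]; first by rewrite mxE mulr_ge0.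
rewrite (reindex (@mxtens_index m p)) /=; last first.
  by exists (@mxtens_unindex m p) => i _;
    rewrite (mxtens_indexK, mxtens_unindexK).
under eq_bigr do rewrite mxE mxtens_indexK.
rewrite -(pair_bigA _
  (fun i k => A i (mxtens_unindex j).1 * B k (mxtens_unindex j).2))/=.
under eq_bigr do rewrite -mulr_sumr B1 mulr1.
exact: A1.
Qed.

Lemma colstoch_conform m p (B : 'M[R]_p) (A : 'M[R]_m) :
  m = p -> colstoch A -> colstoch (conform_mx B A).
Proof. by move=> e; subst p; rewrite conform_mx_id. Qed.

Lemma colstoch_Amat S s : (1 <= s <= S)%N -> colstoch (Amat R S s).
Proof.
move=> /andP[s1 sS]; apply: colstoch_conform.
  (* The dimensions agree, so [conform_mx] returns the Kronecker product and not its default 0. *)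
  by rewrite -expnSr -expnD; congr (2 ^ _)%N; lia.
apply: colstoch_tens; last exact: colstoch1.
apply: colstoch_tens; first exact: colstoch1.
split=> [i j|j]; first by rewrite !mxE mulr1 invr_ge0.
by rewrite big_ord_recl big_ord1 !mxE; lra.
Qed.

Lemma colstoch_alpha S (tau : R) s w : (1 <= s <= S)%N ->
  colstoch (alpha (S := S) tau s w).
Proof.
move=> sS; rewrite /alpha; case: ifP => _; last exact: colstoch1.
exact: colstoch_Amat.
Qed.

End colstoch.

Section weights.
Context {R : realType} (S : nat) (tau : R).
Implicit Types w : 'I_(2 ^ S) -> R.

Lemma mixW_ge0 s w : (1 <= s <= S)%N -> (forall k, 0 <= w k) ->
  forall k, 0 <= mixW tau s w k.
Proof.
move=> sS w0 k; apply: sumr_ge0 => l _; apply: mulr_ge0 => //.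
by have [] := colstoch_alpha tau w sS.
Qed.

Lemma sum_mixW s w : (1 <= s <= S)%N ->
  \sum_k mixW tau s w k = \sum_k w k.
Proof.
move=> sS; rewrite exchange_big/=; apply: eq_bigr => l _.
by rewrite -mulr_suml; have [_ ->] := colstoch_alpha tau w sS; rewrite mul1r.
Qed.

Lemma Wmid_ge0 w s : (s <= S)%N -> (forall k, 0 <= w k) ->
  forall k, 0 <= Wmid tau w s k.
Proof.
move=> sS w0; elim: s sS => [//|s IHs] sS /=.
by apply: mixW_ge0 => //; apply: IHs; exact: ltnW.
Qed.

Lemma sum_Wmid w s : (s <= S)%N -> \sum_k Wmid tau w s k = \sum_k w k.
Proof.
elim: s => [//|s IHs] sS /=.
by rewrite sum_mixW//; apply: IHs; exact: ltnW.
Qed.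

Context {X : Type} {M : nat} (g : nat -> X -> R).
Hypothesis g_ge0 : forall n x, 0 <= g n x.
Implicit Types x : nat -> 'I_(2 ^ S) -> 'I_M -> X.

Lemma Wn1_ge0 n w (y : 'I_(2 ^ S) -> 'I_M -> X) : (forall k, 0 <= w k) ->
  forall k, 0 <= Wn1 (g n) w y k.
Proof.
move=> w0 k; rewrite /Wn1 mulr_ge0// mulr_ge0// ?invr_ge0//.
exact: sumr_ge0.
Qed.

Lemma W0_ge0 x n k : 0 <= W0 tau g x n k.
Proof.
elim: n k => [k|n IHn k] /=; first exact: ler01.
by apply: Wmid_ge0 => //; exact: Wn1_ge0.
Qed.

Lemma Wgt_ge0 x n s k : (s <= S.+1)%N -> 0 <= Wgt tau g x n s k.
Proof.
case: s => [_|s sS] /=; first exact: W0_ge0.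
by apply: Wmid_ge0 => //; apply: Wn1_ge0; exact: W0_ge0.
Qed.

(** Stage 0 is left out because internal resampling multiplies each weight by the mean potential of
    its block, which changes the total. *)
Lemma sum_Wgt x n s : (1 <= s <= S.+1)%N ->
  \sum_k Wgt tau g x n s k = \sum_k Wgt tau g x n 1 k.
Proof. by case: s => [//|s] sS /=; rewrite sum_Wmid. Qed.

Lemma WgtS x n s : (1 <= s)%N ->
  Wgt tau g x n s.+1 = mixW tau s (Wgt tau g x n s).
Proof. by case: s. Qed.

End weights.

Section measurable_weights.
Context {R : realType} {d : measure_display} {T : measurableType d}.
Context (S : nat) (tau : R).

(** The adaptive test makes the mixing matrix random. The denominator of [ess] may vanish, hence the
    appeal to [measurable_fun_inv]. *)
Lemma measurable_alpha s (w : T -> 'I_(2 ^ S) -> R) :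
  (forall k, measurable_fun setT (fun t => w t k)) ->
  forall k l, measurable_fun setT (fun t => alpha tau s (w t) k l).
Proof.
move=> mw k l; rewrite /alpha.
under eq_fun do rewrite (fun_if (fun A : 'M[R]_(2 ^ S) => A k l)).
apply: measurable_fun_ifT => //; apply: measurable_fun_ltr => //.
apply: measurable_funM.
  apply: measurable_funX; apply: measurable_funM => //.
  exact: measurable_sum.
apply: measurable_fun_inv; apply: measurable_funM => //.
by apply: measurable_sum => i; exact: measurable_funX.
Qed.

Lemma measurable_mixW s (w : T -> 'I_(2 ^ S) -> R) :
  (forall k, measurable_fun setT (fun t => w t k)) ->
  forall k, measurable_fun setT (fun t => mixW tau s (w t) k).
Proof.
move=> mw k; apply: measurable_sum => l; apply: measurable_funM => //.
exact: measurable_alpha.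
Qed.

Lemma measurable_Wmid s (w : T -> 'I_(2 ^ S) -> R) :
  (forall k, measurable_fun setT (fun t => w t k)) ->
  forall k, measurable_fun setT (fun t => Wmid tau (w t) s k).
Proof.
by move=> mw; elim: s => [//|s IHs] /=; exact: measurable_mixW.
Qed.

Context {dX : measure_display} {X : measurableType dX} (M : nat).
Variable g : nat -> X -> R.
Hypothesis mg : forall n, measurable_fun setT (g n).
Implicit Types x : nat -> 'I_(2 ^ S) -> 'I_M -> T -> X.

Lemma measurable_Wn1 n (w : T -> 'I_(2 ^ S) -> R)
    (y : 'I_(2 ^ S) -> 'I_M -> T -> X) :
  (forall k, measurable_fun setT (fun t => w t k)) ->
  (forall k i, measurable_fun setT (y k i)) ->
  forall k, measurable_fun setT
    (fun t => Wn1 (g n) (w t) (fun k i => y k i t) k).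
Proof.
move=> mw my k; apply: measurable_funM => //; apply: measurable_funM => //.
by apply: measurable_sum => i; exact: measurableT_comp.
Qed.

Lemma measurable_W0 n x :
  (forall p k i, (p < n)%N -> measurable_fun setT (x p k i)) ->
  forall k, measurable_fun setT
    (fun t => W0 tau g (fun p k i => x p k i t) n k).
Proof.
elim: n => [|n IHn] mx k /=; first exact: measurable_cst.
apply: measurable_Wmid => {}k; apply: measurable_Wn1 => [{}k|{}k i].
  by apply: IHn => p {}k i pn; apply: mx; exact: ltnW.
exact: mx.
Qed.

Lemma measurable_Wgt n s x :
  (forall p k i, (p <= n)%N -> measurable_fun setT (x p k i)) ->
  forall k, measurable_fun setT
    (fun t => Wgt tau g (fun p k i => x p k i t) n s k).
Proof.
move=> mx; have mx' p k i : (p < n)%N -> measurable_fun setT (x p k i).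
  by move=> /ltnW; exact: mx.
case: s => [|s] k /=; first exact: measurable_W0.
apply: measurable_Wmid => {}k; apply: measurable_Wn1 => [{}k|{}k i].
  exact: measurable_W0.
exact: mx.
Qed.

End measurable_weights.

(** * Mutation and resampling operators *)

Section kernel_operator.
Context {R : realType} {d : measure_display} {X : measurableType d}.
Implicit Types (L : R.-pker X ~> X) (f : X -> R).

Lemma pker_fin L x : (L x setT < +oo)%E.
Proof. by rewrite prob_kernel ltry. Qed.

Lemma Kop_linear L a f h : bmeas f -> bmeas h -> forall x,
  Kop L (fun z => a * f z + h z) x = a * Kop L f x + Kop L h x.
Proof. by move=> bf bh x; exact: (E_linear (pker_fin L x)). Qed.

Lemma Kop_bound L c f : bmeas f -> (forall x, `|f x| <= c) ->
  forall x, `|Kop L f x| <= c.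
Proof.
move=> bf fc x; have := E_bound (pker_fin L x) bf fc.
by rewrite prob_kernel mulr1.
Qed.

Lemma Kop_indic L B x : measurable B -> Kop L \1_B x = fine (L x B).
Proof. by move=> mB; rewrite /Kop integral_indic// setIT. Qed.

Lemma Kop_cst L c x : Kop L (fun=> c) x = c.
Proof.
have -> : Kop L (fun=> c) x = Rintegral (L x) setT (fun=> c) by [].
by rewrite Rintegral_cst// prob_kernel mulr1.
Qed.

Lemma bmeas_Kop L f : bmeas f -> bmeas (Kop L f).
Proof.
move=> bf; have [mf [c fc]] := bf; split; last by exists c; exact: Kop_bound.
(* The measurability result for kernel integrals is applied to a nonnegative integrand. Adding c to
   f achieves this, and a Markov kernel integrates c to c. *)
have -> : Kop L f = (fun x => Kop L (fun y => 1 * f y + c) x - c).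
  apply/funext => x; rewrite Kop_linear//; last exact: bmeas_cst.
  by rewrite Kop_cst mul1r addrK.
apply: measurable_funB => //; rewrite /Kop.
apply: (measurableT_comp (fine_measurable measurableT)).
apply: measurable_fun_integral_kernel => [U mU|y|].
- exact: measurable_kernel.
- rewrite lee_fin mul1r -lerBlDr sub0r.
  by have := fc y; rewrite ler_norml => /andP[].
- apply/measurable_EFinP; apply: measurable_funD => //.
  exact: measurable_funM.
Qed.

End kernel_operator.

Section resampling_operator.
Context {R : realType} {X : Type} {M : nat}.
Implicit Types (gn f : X -> R) (x : 'I_M -> X).

(** Extends [qres] from sets to functions; at [\1_B] the two are convertible. *)
Definition qresf gn x f : R :=
  let D := \sum_j gn (x j) in
  if D == 0 then M%:R^-1 * \sum_j f (x j)
  else (\sum_j gn (x j) * f (x j)) / D.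

Lemma qresf_linear gn x a f h :
  qresf gn x (fun z => a * f z + h z) = a * qresf gn x f + qresf gn x h.
Proof.
rewrite /qresf/=; case: ifP => _.
  by rewrite mulrCA -mulrDr; congr (_ * _); rewrite mulr_sumr -big_split.
rewrite mulrA -mulrDl; congr (_ / _); rewrite mulr_sumr -big_split/=.
by apply: eq_bigr => j _; ring.
Qed.

Lemma qresf_bound gn x c f : (0 < M)%N -> (forall z, 0 <= gn z) ->
  (forall z, `|f z| <= c) -> `|qresf gn x f| <= c.
Proof.
move=> M0 gn0 fc; rewrite /qresf/=; case: ifPn => [_|D0].
  rewrite normrM ger0_norm ?invr_ge0// ler_pdivrMl ?ltr0n//.
  rewrite (le_trans (ler_norm_sum _ _ _))//.
  rewrite (le_trans (ler_sum _ (fun i _ => fc (x i))))//.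
  by rewrite sumr_const card_ord mulr_natl.
have Dgt0 : 0 < \sum_j gn (x j) by rewrite lt_neqAle eq_sym D0 sumr_ge0.
rewrite normf_div (gtr0_norm Dgt0) ler_pdivrMr//.
rewrite (le_trans (ler_norm_sum _ _ _))// mulr_sumr ler_sum// => j _.
by rewrite normrM (ger0_norm (gn0 _)) mulrC ler_wpM2r.
Qed.

Lemma qresf1 gn x : (0 < M)%N -> qresf gn x \1_setT = 1.
Proof.
move=> M0; rewrite /qresf/=; case: ifPn => [_|D0].
  under eq_bigr do rewrite indicT.
  by rewrite sumr_const card_ord mulVf// pnatr_eq0 -lt0n.
by under eq_bigr do rewrite indicT mulr1; rewrite mulfV.
Qed.

End resampling_operator.

Lemma bmeas_qresf d (T : measurableType d) d' (X : measurableType d')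
    (R : realType) M (gn f : X -> R) (x : 'I_M -> T -> X) :
  (0 < M)%N -> (forall x, 0 <= gn x) -> measurable_fun setT gn ->
  (forall j, measurable_fun setT (x j)) -> bmeas f ->
  bmeas (fun t => qresf gn (fun j => x j t) f).
Proof.
move=> M0 gn0 mgn mx [mf [c fc]]; split; last first.
  by exists c => t; exact: qresf_bound.
have mD : measurable_fun setT (fun t => \sum_j gn (x j t)).
  by apply: measurable_sum => j; exact: measurableT_comp.
apply: measurable_fun_ifT.
- exact: measurable_fun_eqr.
- apply: measurable_funM => //.
  by apply: measurable_sum => j; exact: measurableT_comp.
- apply: measurable_funM; last exact: measurable_fun_inv.
  apply: measurable_sum => j.
  by apply: measurable_funM; exact: measurableT_comp.
Qed.

(** The marginal of a product law. [F'] keeps only the entry l in row k, so the product of its row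
    sums is [F k l]; distributing that product over all maps f gives the left side. *)
Lemma sum_prod_marginal (R : comPzRingType) (I J : finType) (F : I -> J -> R)
    (k : I) (l : J) : (forall i, \sum_j F i j = 1) ->
  \sum_(f : {ffun I -> J}) (f k == l)%:R * \prod_i F i (f i) = F k l.
Proof.
move=> F1.
pose F' i j := if i == k then (j == l)%:R * F k j else F i j.
have : \prod_i \sum_j F' i j = \sum_(f : {ffun I -> J}) \prod_i F' i (f i).
  exact: bigA_distr_bigA.
rewrite (bigD1 k)//= [X in _ * X]big1 => [|i ik].
  rewrite mulr1 {1}/F' eqxx (bigD1 l)//= eqxx mul1r big1 ?addr0 => [->|j jl].
    apply: eq_bigr => f _.
    rewrite [in LHS](bigD1 k)//= [in RHS](bigD1 k)//= /F' eqxx.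
    by rewrite mulrA; congr (_ * _); apply: eq_bigr => i /negbTE ->.
  by rewrite (negbTE jl) mul0r.
by rewrite -[RHS](F1 i); apply: eq_bigr => j _; rewrite /F' (negbTE ik).
Qed.

(** The fields of [AIRPF] prescribe joint laws of all particles; the full set at every place but (k,
    i) extracts the law of a single particle. *)
Lemma prod_single (R : comPzRingType) (I J : finType) (T : Type)
    (q : I -> J -> set T -> R) k i (B : set T) :
  (forall k' i', q k' i' setT = 1) ->
  \prod_k' \prod_i' q k' i' (if (k' == k) && (i' == i) then B else setT) =
  q k i B.
Proof.
move=> q1; rewrite (bigD1 k)//=.
rewrite [X in _ * X]big1 => [|k' /negbTE k'k]; last first.
  by rewrite big1// => i' _; rewrite k'k.
rewrite mulr1 (bigD1 i)//= !eqxx big1 ?mulr1// => i' /negbTE ->.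
by rewrite andbF.
Qed.

Lemma preimage_single (Om T : Type) (I J : finType) (y : I -> J -> Om -> T)
    k i (B : set T) :
  [set w | forall k' i',
     (if (k' == k) && (i' == i) then B else setT) (y k' i' w)] =
  y k i @^-1` B.
Proof.
apply/seteqP; split => w /= => [/(_ k i)|Bw k' i']; first by rewrite !eqxx.
by case: andP => // -[/eqP -> /eqP ->].
Qed.

(** * One time step of the algorithm *)

Section airpf.
Context {R : realType} {dO : measure_display} {Om : measurableType dO}.
Context {P : probability Om R} {dX : measure_display} {X : measurableType dX}.
Context {S M : nat} {tau : R} (pi0 : probability X R).
Context {K : nat -> R.-pker X ~> X} {g : nat -> X -> R}.
Hypothesis M_gt0 : (0 < M)%N.
Hypothesis mg : forall n, measurable_fun setT (g n).
Hypothesis g_ge0 : forall n x, 0 <= g n x.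
Variable A : AIRPF P S M tau pi0 K g.

Local Notation E f := (Rintegral P setT f).
Local Notation x_ := (fun w p k i => xi A p 0%N k i w).

Let P_fin : (P setT < +oo)%E.
Proof. by rewrite probability_setT ltry. Qed.

(* [filtF] and [past] are convertible to the sigma-algebras generated by
   [filt_gen] and [past_gen]; measurability with respect to them is expressed
   on the type [g_sigma_algebraType], which makes library lemmas available. *)
Definition filt_gen (n : nat) : set (set Om) :=
  [set E | exists p k i (B : set X),
     [/\ (p <= n)%N, measurable B & E = xi A p 0%N k i @^-1` B]].

Definition past_gen (t : nat) : set (set Om) :=
  [set E | (exists p s k i (B : set X),
              [/\ (s <= S)%N, (rank_xi S p s < t)%N, measurable B &
                  E = xi A p s k i @^-1` B])
         \/ (exists p s k l,
              [/\ (1 <= s <= S)%N, (rank_L S p s < t)%N &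
                  E = Lidx A p s k @^-1` [set l]])].

Let preimage_xi p s k i B : measurable B -> measurable (xi A p s k i @^-1` B).
Proof. by move=> mB; rewrite -[_ @^-1` _]setTI; exact: xi_meas. Qed.

Lemma filt_gen_measurable n B : filt_gen n B -> measurable B.
Proof. by move=> [p [k [i [C [_ mC ->]]]]]; exact: preimage_xi. Qed.

Lemma past_gen_measurable t B : past_gen t B -> measurable B.
Proof.
move=> [[p [s [k [i [C [_ _ mC ->]]]]]]|[p [s [k [l [_ _ ->]]]]]].
- exact: preimage_xi.
- exact: Lidx_meas.
Qed.

(** The bound is the rank of the particles xi_{n,0}, the last ones that generate F_n. *)
Lemma filt_gen_past n t B : (n * (2 * S + 2) < t)%N ->
  filt_gen n B -> <<s past_gen t >> B.
Proof.
move=> nt [p [k [i [C [pn mC ->]]]]]; apply: sub_sigma_algebra; left.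
exists p, 0%N, k, i, C; split => //.
by rewrite (leq_ltn_trans _ nt)// /rank_xi eqxx leq_mul2r pn orbT.
Qed.

Lemma filt_past n t B : (n * (2 * S + 2) < t)%N ->
  <<s filt_gen n >> B -> past (xi A) (Lidx A) t B.
Proof. by move=> nt; apply: g_sigma_mono => C; exact: filt_gen_past. Qed.

Local Notation bmeas_filt n := (@bmeas _ (g_sigma_algebraType (filt_gen n)) R).
Local Notation bmeas_past t := (@bmeas _ (g_sigma_algebraType (past_gen t)) R).

Lemma measurable_xi_filt n p k i : (p <= n)%N ->
  measurable_fun [set: g_sigma_algebraType (filt_gen n)] (xi A p 0%N k i).
Proof.
move=> pn _ B mB; rewrite setTI; apply: sub_sigma_algebra.
by exists p, k, i, B.
Qed.

Lemma measurable_xi_past t p s k i : (s <= S)%N -> (rank_xi S p s < t)%N ->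
  measurable_fun [set: g_sigma_algebraType (past_gen t)] (xi A p s k i).
Proof.
move=> sS pst _ B mB; rewrite setTI; apply: sub_sigma_algebra.
by left; exists p, s, k, i, B.
Qed.

(** * Random weights and their normalisation *)

Definition W n s k w : R := Wgt tau g (x_ w) n s k.

Lemma W_ge0 n s k w : (s <= S.+1)%N -> 0 <= W n s k w.
Proof. exact: Wgt_ge0. Qed.

Lemma sum_W n s w : (1 <= s <= S.+1)%N ->
  \sum_k W n s k w = \sum_k W n 1 k w.
Proof. exact: sum_Wgt. Qed.

Lemma measurable_W n s k :
  measurable_fun [set: g_sigma_algebraType (filt_gen n)] (W n s k).
Proof.
apply: measurable_Wgt => // p l i pn; exact: measurable_xi_filt.
Qed.

(* All equal to 0 if the total weight vanishes. Working with these weights in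
   [0, 1] makes the boundedness of [g] irrelevant to integrability. *)
Definition V n s k w : R := W n s k w / \sum_l W n 1 l w.

Lemma V01 n s k w : (1 <= s <= S.+1)%N -> 0 <= V n s k w <= 1.
Proof.
move=> sS; have sS1 : (s <= S.+1)%N by case/andP: sS.
have sum0 : 0 <= \sum_l W n 1 l w by apply: sumr_ge0 => l _; exact: W_ge0.
rewrite /V divr_ge0 ?W_ge0//=.
have [->|nz] := eqVneq (\sum_l W n 1 l w) 0; first by rewrite invr0 mulr0.
rewrite ler_pdivrMr ?lt_neqAle 1?eq_sym ?nz// mul1r -(sum_W n w sS).
by rewrite (bigD1 k)//= lerDl sumr_ge0// => l _; exact: W_ge0.
Qed.

Lemma bmeas_V n s k : (1 <= s <= S.+1)%N -> bmeas_filt n (V n s k).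
Proof.
move=> sS; split.
  apply: measurable_funM; first exact: measurable_W.
  apply: measurable_fun_inv; apply: measurable_sum => l; exact: measurable_W.
by exists 1 => w; have /andP[? ?] := V01 n k w sS; rewrite ger0_norm.
Qed.

Let bmeasF n (Z : Om -> R) : bmeas_filt n Z -> bmeas Z.
Proof. exact/bmeas_sub/filt_gen_measurable. Qed.

Let bmeas_xi n s k i (f : X -> R) :
  bmeas f -> bmeas (fun w => f (xi A n s k i w)).
Proof. by apply: bmeas_comp; exact: xi_meas. Qed.

(** The preimage is split according to the finitely many values of the index. *)
Lemma measurable_selected n s k i :
  measurable_fun setT (fun w => xi A n s (Lidx A n s k w) i w).
Proof.
move=> _ B mB; rewrite setTI.
rewrite (_ : _ @^-1` _ = \big[setU/set0]_(l : 'I_(2 ^ S))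
    (Lidx A n s k @^-1` [set l] `&` xi A n s l i @^-1` B)); last first.
  apply/seteqP; split => w /=.
    move=> Bw; rewrite -bigcup_seq; exists (Lidx A n s k w) => //=.
    by rewrite mem_index_enum.
  by rewrite -bigcup_seq => -[l _ /= [-> ?]].
apply: bigsetU_measurable => l _; apply: measurableI; first exact: Lidx_meas.
exact: preimage_xi.
Qed.

(** * Mutation and internal resampling of one particle *)

Definition mutated_from n k i w : X :=
  if S == 0%N then xi A n 1%N k i w else xi A n S (Lidx A n S k w) i w.

Lemma measurable_mutated_from n k i : measurable_fun setT (mutated_from n k i).
Proof.
rewrite /mutated_from; case: eqP => _; first exact: xi_meas.
exact: measurable_selected.
Qed.

(** [mutate] holds on every event of the past of xi_{n+1,0} but is used only on F_n. The parent
    [mutated_from] need not be F_n-measurable, which [E_cond_step] allows. *)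
Lemma mutate_step n k i (Z : Om -> R) (f : X -> R) :
  bmeas_filt n Z -> bmeas f ->
  E (fun w => Z w * f (xi A n.+1 0%N k i w)) =
  E (fun w => Z w * Kop (K n.+1) f (mutated_from n k i w)).
Proof.
apply: (E_cond_step P_fin
  (L := fun f w => Kop (K n.+1) f (mutated_from n k i w))).
- exact: filt_gen_measurable.
- exact: xi_meas.
- move=> h bh; apply: (bmeas_comp (measurable_mutated_from n k i)).
  exact: bmeas_Kop.
- by move=> a h h' bh bh' w; exact: Kop_linear.
- exists 1 => h bh h01 w; apply: Kop_bound => // z.
  by have /andP[? ?] := h01 z; rewrite ger0_norm.
- move=> B C FB mC; rewrite -(preimage_single (xi A n.+1 0%N) k i C).
  pose D (k' : 'I_(2 ^ S)) (i' : 'I_M) :=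
    if (k' == k) && (i' == i) then C else setT.
  have mD k' i' : measurable (D k' i') by rewrite /D; case: ifP.
  transitivity (\int[P]_(w in B) (\prod_k' \prod_i'
      fine (K n.+1 (mutated_from n k' i' w) (D k' i')))%:E)%E.
    by apply: mutate => //; apply: filt_past FB; rewrite /rank_xi eqxx; nia.
  apply: eq_integral => w _; congr EFin.
  rewrite Kop_indic// (prod_single (q := fun k' i' D =>
    fine (K n.+1 (mutated_from n k' i' w) D)))//.
  by move=> k' i'; rewrite prob_kernel.
Qed.

Lemma resample_step n k i (Z : Om -> R) (f : X -> R) :
  bmeas_filt n Z -> bmeas f ->
  E (fun w => Z w * f (xi A n 1%N k i w)) =
  E (fun w => Z w * qresf (g n) (fun j => xi A n 0%N k j w) f).
Proof.
apply: (E_cond_step P_fin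
  (L := fun f w => qresf (g n) (fun j => xi A n 0%N k j w) f)).
- exact: filt_gen_measurable.
- exact: xi_meas.
- by move=> h bh; apply: bmeas_qresf => // j; exact: xi_meas.
- by move=> a h h' bh bh' w; exact: qresf_linear.
- exists 1 => h bh h01 w; apply: qresf_bound => // z.
  by have /andP[? ?] := h01 z; rewrite ger0_norm.
- move=> B C FB mC; rewrite -(preimage_single (xi A n 1%N) k i C).
  pose D (k' : 'I_(2 ^ S)) (i' : 'I_M) :=
    if (k' == k) && (i' == i) then C else setT.
  have mD k' i' : measurable (D k' i') by rewrite /D; case: ifP.
  transitivity (\int[P]_(w in B) (\prod_k' \prod_i'
      qres (g n) (fun j => xi A n 0%N k' j w) (D k' i'))%:E)%E.
    by apply: resample => //; apply: filt_past FB; rewrite /rank_xi/=; lia.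
  apply: eq_integral => w _; congr EFin.
  rewrite (prod_single (q := fun k' i' D =>
    qres (g n) (fun j => xi A n 0%N k' j w) D))//.
  by move=> k' i'; exact: qresf1.
Qed.

(** * Selection between filters *)

Definition pLw n s k l w : R := pL tau s ((W n s)^~ w) ((W n s.+1)^~ w) k l.

Lemma pLw_ge0 n s k l w : (1 <= s <= S)%N -> 0 <= pLw n s k l w.
Proof.
move=> /andP[s1 sS]; rewrite /pLw /pL; case: ifP => _; first exact: ler0n.
apply: divr_ge0; last exact: W_ge0.
apply: mulr_ge0; last by apply: W_ge0; exact: ltnW.
by have [] := colstoch_alpha tau ((W n s)^~ w) (introT andP (conj s1 sS)).
Qed.

Lemma W_mix n s k w : (1 <= s)%N ->
  W n s.+1 k w = \sum_l alpha tau s ((W n s)^~ w) k l * W n s l w.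
Proof. by move=> s1; rewrite /W WgtS. Qed.

Lemma sum_pLw n s k w : (1 <= s <= S)%N -> \sum_l pLw n s k l w = 1.
Proof.
move=> /andP[s1 sS]; rewrite /pLw /pL/=.
have [W0|W0] := eqVneq (W n s.+1 k w) 0.
  rewrite (bigD1 k)//= eqxx big1 => [|l /negbTE -> //].
  by rewrite addr0.
by rewrite -mulr_suml -W_mix// mulfV.
Qed.

(** When the new weight is 0, every term of the nonnegative sum defining it is 0, so the fallback
    value of [pL] never shows. *)
Lemma W_pLw n s k l w : (1 <= s <= S)%N ->
  W n s.+1 k w * pLw n s k l w = alpha tau s ((W n s)^~ w) k l * W n s l w.
Proof.
move=> sS; have /andP[s1 s1S] := sS.
rewrite /pLw /pL; case: ifPn => [/eqP W0|W0]; last by rewrite mulrC mulfVK.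
rewrite W0 mul0r; apply/esym/eqP; move: W0; rewrite W_mix// => /eqP.
rewrite psumr_eq0 => [/allP/(_ l)|l' _].
  by rewrite mem_index_enum => /(_ isT).
apply: mulr_ge0; last by apply: W_ge0; exact: ltnW.
by have [] := colstoch_alpha tau ((W n s)^~ w) sS.
Qed.

Lemma bmeas_pLw n s k l : (1 <= s <= S)%N -> bmeas (pLw n s k l).
Proof.
move=> sS; have mW' s' k' : measurable_fun setT (W n s' k').
  exact: (measurable_sub (@filt_gen_measurable n) (@measurable_W n s' k')).
split.
  apply: measurable_fun_ifT => //; first exact: measurable_fun_eqr.
  apply: measurable_funM; last exact: measurable_fun_inv.
  apply: measurable_funM => //.
  exact: (measurable_alpha tau s (w := fun w => (W n s)^~ w)).
exists 1 => w; rewrite ger0_norm ?pLw_ge0// -(sum_pLw n k w sS).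
by rewrite (bigD1 l)//= lerDl sumr_ge0// => l' _; exact: pLw_ge0.
Qed.

(** U may depend on the whole past, since it will contain particles of stage s, which are not
    F_n-measurable in general. [select] gives the joint law of all indices of the stage; summing
    over the maps h with h k = l gives the law of L_k. *)
Lemma select_step n s k l (U : Om -> R) : (1 <= s <= S)%N ->
  bmeas_past (rank_L S n s) U ->
  E (fun w => U w * \1_(Lidx A n s k @^-1` [set l]) w) =
  E (fun w => U w * pLw n s k l w).
Proof.
move=> sS; apply: (E_extend P_fin).
- exact: past_gen_measurable.
- by apply: bmeas_indic; exact: Lidx_meas.
- exact: bmeas_pLw.
move=> B FB; have mB := g_sigma_sub (@past_gen_measurable _) FB.
pose ev (h : {ffun 'I_(2 ^ S) -> 'I_(2 ^ S)}) :=
  [set w | forall k', Lidx A n s k' w = h k'].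
have mev h : measurable (ev h).
  rewrite (_ : ev h = \big[setI/setT]_(k' : 'I_(2 ^ S))
      (Lidx A n s k' @^-1` [set h k'])).
    by apply: bigsetI_measurable => k' _; exact: Lidx_meas.
  rewrite -bigcap_seq; apply/seteqP; split => w /= => [hw k' _|hw k'].
    exact: hw.
  by apply: hw; rewrite /= mem_index_enum.
pose pr h w := \prod_k' pLw n s k' (h k') w.
have bpr (h : {ffun 'I_(2 ^ S) -> 'I_(2 ^ S)}) : bmeas (pr h).
  rewrite /pr; elim: (index_enum _) => [|k' r IHr].
    by under eq_fun do rewrite big_nil; exact: bmeas_cst.
  by under eq_fun do rewrite big_cons; apply: bmeasM => //; exact: bmeas_pLw.
have b1 C : measurable C -> bmeas (fun w : Om => \1_C w : R).
  exact: bmeas_indic.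
have e1 w : \1_(Lidx A n s k @^-1` [set l]) w =
    \sum_(h : {ffun 'I_(2 ^ S) -> 'I_(2 ^ S)}) (h k == l)%:R * \1_(ev h) w :> R.
  (* The only h whose event contains w. *)
  pose h0 : {ffun 'I_(2 ^ S) -> 'I_(2 ^ S)} := [ffun k' => Lidx A n s k' w].
  rewrite (bigD1 h0)//= big1 ?addr0 => [|h hh0].
    rewrite !indicE [_ \in ev h0]mem_set/=; last by move=> k'; rewrite ffunE.
    rewrite mulr1 ffunE; congr (_%:R); congr nat_of_bool.
    by apply/idP/eqP => [|e]; [rewrite inE|rewrite inE].
  rewrite indicE memNset ?mulr0// => hw; case/eqP: hh0; apply/ffunP => k'.
  by rewrite ffunE -hw.
have e2 w : pLw n s k l w =
    \sum_(h : {ffun 'I_(2 ^ S) -> 'I_(2 ^ S)}) (h k == l)%:R * pr h w.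
  rewrite -(sum_prod_marginal (F := fun k' l' => pLw n s k' l' w))// => k'.
  by rewrite sum_pLw.
under eq_Rintegral do rewrite e1 mulr_sumr.
under [RHS]eq_Rintegral do rewrite e2 mulr_sumr.
rewrite !E_sum//; first last.
- move=> h; apply: bmeasM; first exact: b1.
  by apply: bmeasM; [exact: bmeas_cst|exact: b1].
- by move=> h; apply: bmeasM; [exact: b1|apply: bmeasM => //; exact: bmeas_cst].
apply: eq_bigr => h _.
under eq_Rintegral do rewrite mulrCA.
under [RHS]eq_Rintegral do rewrite mulrCA.
rewrite !RintegralZl//; first last.
- by apply: bmeas_integrable => //; apply: bmeasM; exact: b1.
- by apply: bmeas_integrable => //; apply: bmeasM => //; exact: b1.
congr (_ * _); rewrite E_indicI// E_indicl; congr fine.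
exact: select.
Qed.

Lemma V_mix n s l w : (1 <= s <= S)%N ->
  \sum_k V n s.+1 k w * pLw n s k l w = V n s l w.
Proof.
move=> sS; rewrite /V.
under eq_bigr => k _ do rewrite mulrAC W_pLw// -mulrA.
rewrite -mulr_suml.
by have [_ ->] := colstoch_alpha tau ((W n s)^~ w) sS; rewrite mul1r.
Qed.

Lemma select_sum n s i (Z : Om -> R) (f : X -> R) : (1 <= s <= S)%N ->
  bmeas_filt n Z -> bmeas f ->
  \sum_k E (fun w => Z w * V n s.+1 k w * f (xi A n s (Lidx A n s k w) i w)) =
  \sum_k E (fun w => Z w * V n s k w * f (xi A n s k i w)).
Proof.
move=> sS bZ bf; have /andP[s1 s1S] := sS.
have sS1 : (1 <= s.+1 <= S.+1)%N by [].
have ts : (n * (2 * S + 2) < rank_L S n s)%N by rewrite /rank_L; lia.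
have bU k l : bmeas_past (rank_L S n s)
    (fun w : Om => Z w * V n s.+1 k w * f (xi A n s l i w)).
  apply: bmeasM; first apply: bmeasM.
  - exact: (bmeas_mono (fun B => @filt_gen_past n _ B ts)).
  - apply: (bmeas_mono (fun B => @filt_gen_past n _ B ts)); exact: bmeas_V.
  - apply: bmeas_comp bf; apply: measurable_xi_past => //.
    (* For s >= 1, xi_{n,s} comes just before L_{n,s} in the order of generation. *)
    by rewrite /rank_xi /rank_L; case: eqP; lia.
have bU' k l : bmeas (fun w => Z w * V n s.+1 k w * f (xi A n s l i w)).
  exact: (bmeas_sub (@past_gen_measurable _) (bU k l)).
have mL k l : bmeas (fun w => \1_(Lidx A n s k @^-1` [set l]) w : R).
  by apply: bmeas_indic; exact: Lidx_meas.
(* Splitting over the value l of L_k replaces the selected particle by a fixed one, times an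
   indicator to which [select_step] applies. *)
transitivity (\sum_k \sum_l
    E (fun w => Z w * V n s.+1 k w * f (xi A n s l i w) * pLw n s k l w)).
  apply: eq_bigr => k _; under [RHS]eq_bigr => l _ do rewrite -select_step//.
  rewrite -E_sum// => [|l]; last exact: bmeasM.
  apply: eq_Rintegral => w _.
  rewrite (bigD1 (Lidx A n s k w))//= big1 ?addr0 => [|l lL].
    by rewrite indicE mem_set ?mulr1.
  by rewrite indicE memNset ?mulr0// => /= e; rewrite e eqxx in lL.
(* The source l is now fixed and the targets k are summed first, as [V_mix] requires. *)
rewrite exchange_big/=; apply: eq_bigr => l _.
rewrite -E_sum// => [|k]; last by apply: bmeasM => //; exact: bmeas_pLw.
apply: eq_Rintegral => w _; rewrite -(V_mix n l w sS) mulr_sumr mulr_suml.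
by apply: eq_bigr => k _; ring.
Qed.

Lemma stage_sum n s i (Z : Om -> R) (f : X -> R) : (1 <= s <= S)%N ->
  bmeas_filt n Z -> bmeas f ->
  \sum_k E (fun w => Z w * V n s k w * f (xi A n s k i w)) =
  \sum_k E (fun w => Z w * V n 1 k w * f (xi A n 1%N k i w)).
Proof.
move=> + bZ bf; elim: s => [//|[_ //|s IHs]] sS.
rewrite -IHs; last exact: ltnW.
rewrite -(select_sum (s := s.+1))//; last exact: ltnW.
by apply: eq_bigr => k _; apply: eq_Rintegral => w _; rewrite copy.
Qed.

(** The selection at stage S leads to mutation and not to a copy, so it is added to [stage_sum]
    separately. For S = 0 the two sides coincide. *)
Lemma mutated_from_sum n i (Z : Om -> R) (f : X -> R) :
  bmeas_filt n Z -> bmeas f ->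
  \sum_k E (fun w => Z w * V n S.+1 k w * f (mutated_from n k i w)) =
  \sum_k E (fun w => Z w * V n 1 k w * f (xi A n 1%N k i w)).
Proof.
move=> bZ bf; rewrite /mutated_from.
have [S0|S0] := eqVneq S 0%N.
  by have -> : S.+1 = 1%N by rewrite S0.
have SS : (1 <= S <= S)%N by rewrite lt0n S0 leqnn.
by rewrite -(stage_sum i SS)// -select_sum.
Qed.

Lemma next_sum n i (Z : Om -> R) (f : X -> R) :
  bmeas_filt n Z -> bmeas f ->
  \sum_k E (fun w => Z w * (V n S.+1 k w * f (xi A n.+1 0%N k i w))) =
  \sum_k E (fun w => Z w * (V n 1 k w *
    qresf (g n) (fun j => xi A n 0%N k j w) (Kop (K n.+1) f))).
Proof.
move=> bZ bf; have bK := bmeas_Kop (K n.+1) bf.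
have bZV s k : (1 <= s <= S.+1)%N ->
    bmeas_filt n (fun w : Om => Z w * V n s k w).
  by move=> sS; apply: bmeasM => //; exact: bmeas_V.
transitivity (\sum_k E (fun w => Z w * V n S.+1 k w *
    Kop (K n.+1) f (mutated_from n k i w))).
  apply: eq_bigr => k _; rewrite -(mutate_step _ _ (bZV S.+1 k _)) ?leqnn//.
  by apply: eq_Rintegral => w _; rewrite mulrA.
rewrite (mutated_from_sum i bZ bK); apply: eq_bigr => k _.
rewrite (resample_step _ _ (bZV 1 k _))//.
by apply: eq_Rintegral => w _; rewrite mulrA.
Qed.

(** * The output measures in terms of normalised weights *)

Lemma piNn_next n f w :
  piNn A n.+1 f w =
  M%:R^-1 * \sum_i \sum_k V n S.+1 k w * f (xi A n.+1 0%N k i w).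
Proof.
rewrite exchange_big mulr_sumr /piNn /piN mulr_suml; apply: eq_bigr => k _.
(* W_{n+1,0} is W_{n,S+1} by definition, and its total is that of stage 1. *)
rewrite -mulr_sumr /V -(sum_W n w (s := S.+1)) ?leqnn// /W /=.
by set d := _^-1; ring.
Qed.

Lemma W1E n k w :
  W n 1 k w = W n 0 k w * (M%:R^-1 * \sum_i g n (xi A n 0%N k i w)).
Proof. by []. Qed.

Lemma piNn_ratio n f w :
  piNn A n (fun x => g n x * f x) w / piNn A n (g n) w =
  \sum_k V n 1 k w * qresf (g n) (fun j => xi A n 0%N k j w) f.
Proof.
rewrite /piNn /piN.
have [W00|W0n0] := eqVneq (\sum_k W n 0 k w) 0.
  (* If the total weight is 0, nonnegativity makes every weight 0, and both sides are 0. *)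
  have W0k k : W n 0 k w = 0.
    apply/eqP; move/eqP: W00; rewrite psumr_eq0 => [/allP/(_ k)|l _].
      by rewrite mem_index_enum => /(_ isT).
    exact: W_ge0.
  rewrite [X in _ / X / _](_ : _ = 0)// invr0 mulr0 mul0r big1// => k _.
  by rewrite /V W1E W0k !mul0r.
(* The total weight of stage 0 cancels between the two output measures. *)
rewrite invfM invrK mulrACA mulVf// mulr1 mulr_suml.
apply: eq_bigr => k _; rewrite /V [in RHS]mulrAC; congr (_ / _).
rewrite W1E -mulrA; congr (_ * _); rewrite /qresf/=.
have [D0|D0] := eqVneq (\sum_j g n (xi A n 0%N k j w)) 0; last first.
  by rewrite -mulrA [X in _ = _ * X]mulrC mulfVK.
(* All potentials of the block vanish: the uniform fallback of [qresf] carries weight 0, and the sum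
   of g f over the block is 0 as well. *)
rewrite D0 mulr0 mul0r; apply/eqP; rewrite mulf_eq0; apply/orP; right.
apply/eqP; rewrite big1// => j _.
have /allP/(_ j) : all (fun j => true ==> (g n (xi A n 0%N k j w) == 0))
    (index_enum 'I_M).
  by rewrite -psumr_eq0 ?D0// => l _; exact: g_ge0.
by rewrite mem_index_enum => /(_ isT)/eqP ->; rewrite mul0r.
Qed.

Lemma bmeas_next n (f : X -> R) : bmeas f -> bmeas (piNn A n.+1 f).
Proof.
move=> bf; rewrite (funext (piNn_next n f)).
apply: bmeasM; first exact: bmeas_cst.
apply: bmeas_sum => i; apply: bmeas_sum => k; apply: bmeasM.
  by apply: (@bmeasF n); apply: bmeas_V; rewrite /= leqnn.
exact: bmeas_xi.
Qed.

Lemma bmeas_ratio n (f : X -> R) : bmeas f ->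
  bmeas_filt n
    (fun w : Om => piNn A n (fun x => g n x * f x) w / piNn A n (g n) w).
Proof.
move=> bf; rewrite (funext (piNn_ratio n f)).
apply: bmeas_sum => k; apply: bmeasM; first exact: bmeas_V.
by apply: bmeas_qresf => // j; exact: measurable_xi_filt.
Qed.

Lemma E_next n (Z : Om -> R) (f : X -> R) :
  bmeas_filt n Z -> bmeas f ->
  E (fun w => Z w * piNn A n.+1 f w) =
  E (fun w => Z w * (piNn A n (fun x => g n x * Kop (K n.+1) f x) w
                     / piNn A n (g n) w)).
Proof.
move=> bZ bf; have bZ' := bmeasF bZ.
have bV s k : (1 <= s <= S.+1)%N -> bmeas (V n s k).
  by move=> sS; exact: (bmeasF (bmeas_V n k sS)).
pose Q k w := V n 1 k w *
  qresf (g n) (fun j => xi A n 0%N k j w) (Kop (K n.+1) f).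
have bQ k : bmeas (fun w => Z w * Q k w).
  apply: bmeasM => //; apply: bmeasM; first exact: bV.
  apply: bmeas_qresf => //; last exact: bmeas_Kop.
  by move=> j; exact: xi_meas.
have bN k i : bmeas (fun w => Z w * (V n S.+1 k w * f (xi A n.+1 0%N k i w))).
  apply: bmeasM => //; apply: bmeasM; last exact: bmeas_xi.
  by apply: bV; rewrite /= leqnn.
under eq_Rintegral.
  move=> w _; rewrite piNn_next mulrCA mulr_sumr.
  under eq_bigr do rewrite mulr_sumr.
  over.
rewrite RintegralZl//; last first.
  by apply: bmeas_integrable => //; apply: bmeas_sum => i; exact: bmeas_sum.
rewrite E_sum// => [|i]; last exact: bmeas_sum.
(* After [next_sum] the summand no longer depends on i, so the average over i disappears. *)
transitivity (M%:R^-1 * \sum_(i < M) \sum_k E (fun w => Z w * Q k w)).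
  by congr (_ * _); apply: eq_bigr => i _; rewrite E_sum// next_sum.
rewrite sumr_const card_ord -[X in _ * X]mulr_natl mulrA mulVf ?mul1r; last first.
  by rewrite pnatr_eq0 -lt0n.
rewrite -E_sum//; apply: eq_Rintegral => w _.
by rewrite piNn_ratio mulr_sumr.
Qed.

End airpf.

(** * The conditional expectation given F_n *)

Lemma integral_E_indic d (T : measurableType d) (R : realType)
    (mu : {measure set T -> \bar R}) (A : set T) (f : T -> R) :
  (mu setT < +oo)%E -> measurable A -> bmeas f ->
  (\int[mu]_(x in A) (f x)%:E)%E =
  (Rintegral mu setT (fun x => \1_A x * f x))%:E.
Proof.
move=> mu_fin mA bf; rewrite E_indicl fineK//.
apply: integrable_fin_num => //.
by apply: (integrableS measurableT) => //; exact: bmeas_integrable.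
Qed.

Unset Implicit Arguments.

Theorem theorem1 (R : realType) (dO : measure_display) (Om : measurableType dO)
  (P : probability Om R) (dX : measure_display) (X : measurableType dX)
  (S M : nat) (tau : R) (pi0 : probability X R)
  (K : nat -> R.-pker X ~> X) (g : nat -> X -> R) :
  (0 < M)%N -> 0 < tau <= 1 ->
  (forall n, measurable_fun setT (g n)) ->
  (forall n x, 0 <= g n x) ->
  (forall n, exists c : R, forall x, g n x <= c) ->
  forall (A : AIRPF P S M tau pi0 K g) (n : nat) (phi : X -> R),
  measurable_fun setT phi -> (exists c : R, forall x, `|phi x| <= c) ->
  cond_exp P (filtF (xi A) n)
    (piNn A n.+1 phi)
    (fun w => piNn A n (fun x => g n x * Kop (K n.+1) phi x) w
              / piNn A n (g n) w).
Proof.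
move=> M0 _ mg g0 _ A n phi mphi bphi.
have bf : bmeas phi by [].
have P_fin : (P setT < +oo)%E by rewrite probability_setT ltry.
have bK := bmeas_ratio M0 mg g0 A n (bmeas_Kop (K n.+1) bf).
have bY := bmeas_next mg g0 A n bf.
have filt_meas := @filt_gen_measurable _ _ _ _ _ _ _ _ _ _ _ _ A n.
have bZ := bmeas_sub filt_meas bK.
split.
- exact: bmeas_integrable.
- exact: bmeas_integrable.
- by move=> B mB; have := bK.1 measurableT B mB; rewrite setTI.
- move=> B FB; have mB := g_sigma_sub filt_meas FB.
  rewrite !integral_E_indic//; congr EFin.
  (* Here Z is [\1_B], which is F_n-measurable because B belongs to F_n. *)
  apply: E_next => //.
  exact: (@bmeas_indic _ (g_sigma_algebraType (filt_gen A n))).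
Qed.
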